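(* Assume that $F(\zeta)$ is invertible and $\zeta\ne\pm1$. For every $\alpha\in\mathbb C^r$ there is a unique generalized eigenfunction $\Psi(\zeta)\alpha=(u_\alpha,g_\alpha)$ of $J$ at $x(\zeta)$ whose tail has the form $$g_\alpha(n)=\zeta^n\alpha+\zeta^{-n}S(\zeta)\alpha\qquad(n\ge1)$$ with incoming amplitude $\alpha$ and some outgoing amplitude, denoted $S(\zeta)\alpha\in\mathbb C^r$. It is given by $$u_\alpha=(\zeta^{-1}-\zeta)F(\zeta)^{-1}V\alpha,\qquad S(\zeta)=-I_r+\frac{\zeta^{-1}-\zeta}{a}V^*F(\zeta)^{-1}V .$$ Consequently $\Psi(\zeta)$ and $S(\zeta)$ are meromorphic matrix-valued functions of $\zeta$.
   Context: Let $q$ be a prime power, $a=\sqrt q$, $d,r\ge1$ integers, $H_C=H_C^*$ a complex $d\times d$ matrix, and $V:\mathbb C^r\to\mathbb C^d$ linear. Consider pairs $(u,g)$ with $u\in\mathbb C^d$ and $g=(g(n))_{n\ge1}$, $g(n)\in\mathbb C^r$ an arbitrary sequence. Define $J(u,g)=(H_Cu+Vg(1),\,h)$, where $h(1)=a\,g(2)+V^*u$ and $h(n)=a\{g(n-1)+g(n+1)\}$ for $n\ge2$ (on square-summable pairs this is a bounded self-adjoint operator). For $\zeta\in\mathbb C^\times$ put $$x(\zeta)=a(\zeta+\zeta^{-1}),\qquad F(\zeta)=H_C-x(\zeta)I_d+\frac{\zeta^{-1}}{a}VV^* .$$ A generalized eigenfunction of $J$ at $x$ is a (not necessarily square-summable)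 pair $f=(u,g)$ with $Jf=xf$. *)

(* Defs.v *)
From HB Require Import structures.
From mathcomp Require Import all_boot all_order all_algebra.
From mathcomp Require Import complex.
From mathcomp Require Import all_classical all_reals all_analysis.

Set Implicit Arguments.
Unset Strict Implicit.
Unset Printing Implicit Defensive.

Import Order.TTheory GRing.Theory Num.Theory.
Import numFieldNormedType.Exports.

Local Open Scope classical_set_scope.
Local Open Scope ring_scope.

Definition is_prime_power (q : nat) : Prop :=
  exists p k : nat, [/\ prime p, (0 < k)%N & q = (p ^ k)%N].

Section Meromorphic.
Variable C : numFieldType.

(* A family f : C -> (I -> C) is read as a function with values in the product
   space C^I.  At every point p of U, the same power of (z - p) and the same
   neighborhood of p must serve for all the coordinates.  The value of f at p
   itself is irrelevant. *)
Definition meromorphic_on (U : set C) (I : Type) (f : C -> I -> C) : Prop :=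
  forall p : C, U p ->
  exists (k : nat) (g : C -> I -> C), \forall z \near p,
    (z != p -> forall i, (z - p) ^+ k * f z i = g z i) /\
    (forall i, derivable (fun w : C^o => g w i : C^o) z 1).

Definition mx_coords (m n : nat) (A : 'M[C]_(m, n)) (ij : 'I_m * 'I_n) : C :=
  A ij.1 ij.2.

End Meromorphic.

Section Scattering.
Variables (R : realType) (d r : nat).
Local Notation C := R[i].

Definition adjmx (m n : nat) (A : 'M[C]_(m, n)) : 'M[C]_(n, m) :=
  (map_mx Num.conj A)^T.

(* Pairs (u, g).  Sequences over n >= 1 are indexed from 0: if f = (u, g),
   then f.2 n is g(n+1). *)
Definition state : Type := ('cV[C]_d * (nat -> 'cV[C]_r))%type.

(* Linear maps from C^r to the space of pairs. *)
Definition mx_state : Type := ('M[C]_(d, r) * (nat -> 'M[C]_r))%type.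

Definition mx_state_apply (P : mx_state) (alpha : 'cV[C]_r) : state :=
  (P.1 *m alpha, fun n => P.2 n *m alpha).

Definition mx_state_coords (P : mx_state)
    (i : ('I_d * 'I_r) + nat * ('I_r * 'I_r)) : C :=
  match i with
  | inl ij => mx_coords P.1 ij
  | inr (n, ij) => mx_coords (P.2 n) ij
  end.

Variable q : nat.

Definition sqrtq : C := (Num.sqrt (q%:R : R))%:C%C.

Definition xparam (zeta : C) : C := sqrtq * (zeta + zeta^-1).

Variables (H : 'M[C]_d) (V : 'M[C]_(d, r)).

Definition J (f : state) : state :=
  (H *m f.1 + V *m f.2 0%N,
   fun n => match n with
            | 0%N => sqrtq *: f.2 1%N + adjmx V *m f.1
            | m.+1 => sqrtq *: (f.2 m + f.2 m.+2)
            end).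

Definition generalized_eigenfunction (x : C) (f : state) : Prop :=
  J f = (x *: f.1, fun n => x *: f.2 n).

Definition F (zeta : C) : 'M[C]_d :=
  H - (xparam zeta)%:M + (zeta^-1 / sqrtq) *: (V *m adjmx V).

Definition has_tail (zeta : C) (alpha beta : 'cV[C]_r) (f : state) : Prop :=
  forall n : nat, f.2 n = zeta ^+ n.+1 *: alpha + zeta ^- n.+1 *: beta.

Definition regular_point (zeta : C) : Prop :=
  [/\ zeta != 0, F zeta \in unitmx, zeta != 1 & zeta != -1].

(* Psi and S are arbitrary outside the regular points. *)
Definition scattering_family (Psi : C -> mx_state) (S : C -> 'M[C]_r) : Prop :=
  forall zeta : C, regular_point zeta -> forall alpha : 'cV[C]_r,
    generalized_eigenfunction (xparam zeta) (mx_state_apply (Psi zeta) alpha) /\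
    has_tail zeta alpha (S zeta *m alpha) (mx_state_apply (Psi zeta) alpha).

End Scattering.

(* Main.v *)
(* A tail zeta^n alpha + zeta^-n beta solves the free recurrence for every n, so
   the eigenvalue equation reduces to its two boundary rows.  They say that
   beta = - alpha + a^-1 V^* u and F(zeta) u = (zeta^-1 - zeta) V alpha, which
   determines u and beta when F(zeta) is invertible.  Since zeta F(zeta) is a
   polynomial matrix whose determinant is not identically zero, Cramer's rule
   makes all the coordinates rational functions of zeta; apart from powers of
   zeta they have a common denominator, so a single pole order serves for
   infinitely many coordinates at each point. *)
Require Import Defs.
From HB Require Import structures.
From mathcomp Require Import all_boot all_order all_algebra.
From mathcomp Require Import complex.
From mathcomp Require Import all_classical all_reals all_analysis.
From mathcomp Require Import ring.

Set Implicit Arguments.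
Unset Strict Implicit.
Unset Printing Implicit Defensive.

Import Order.TTheory GRing.Theory Num.Theory.
Import numFieldNormedType.Exports.

Local Open Scope classical_set_scope.
Local Open Scope ring_scope.

(** * Rational functions as meromorphic functions *)

Lemma derivable_horner_num (C : numFieldType) (p : {poly C}) (x : C) :
  derivable (fun w : C^o => p.[w] : C^o) x 1.
Proof.
elim/poly_ind: p => [|p c IHp].
  have -> : (fun w : C^o => (0 : {poly C}).[w] : C^o) = cst 0.
    by apply/funext => w; rewrite horner0.
  exact: derivable_cst.
have -> : (fun w : C^o => (p * 'X + c%:P).[w] : C^o) =
    (fun w : C^o => p.[w] : C^o) * id + cst c.
  by apply/funext => w; rewrite hornerMXaddC.
apply: derivableD; last exact: derivable_cst.
by apply: derivableM => //; exact: derivable_id.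
Qed.

Lemma near_horner_neq0 (C : numFieldType) (p : {poly C}) (x : C) :
  p.[x] != 0 -> \forall z \near x, p.[z] != 0.
Proof.
move=> px0.
have /derivable1_diffP/differentiable_continuous cp := @derivable_horner_num _ p x.
exact: (@cvgr_neq0 C C^o C^o _ _ _ _ cp px0).
Qed.

(** Write M = E (z - p)^k with E(p) nonzero. Neither k nor a neighborhood of p on which E and z stay
    nonzero depends on i, which gives the required uniformity. There M vanishes at most at p, so the
    formula for f applies at every z other than p. *)
Lemma rational_meromorphic (C : numFieldType) (I : Type) (f : C -> I -> C)
    (M : {poly C}) (N : I -> {poly C}) (n : I -> nat) :
  M != 0 ->
  (forall z, M.[z] != 0 -> forall i, f z i = (N i).[z] / (z ^+ n i * M.[z])) ->
  meromorphic_on [set z : C | z != 0] f.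
Proof.
move=> M0 fE p /= p0; have [k [E]] := multiplicity_XsubC M p.
rewrite M0 /= => Ep0 ME; exists k, (fun z i => (N i).[z] / ('X^(n i) * E).[z]).
have E0 := near_horner_neq0 Ep0.
have X0 : \forall z \near p, ('X : {poly C}).[z] != 0.
  by apply: near_horner_neq0; rewrite hornerX.
near=> z.
have Ez : E.[z] != 0 by near: z.
have z0 : z != 0 by rewrite -[z]hornerX; near: z.
split=> [zp i|i].
- have zpk : (z - p) ^+ k != 0 by rewrite expf_neq0 // subr_eq0.
  have Mz : M.[z] = E.[z] * (z - p) ^+ k by rewrite ME !hornerE.
  rewrite fE Mz ?mulf_neq0 // hornerM hornerXn.
  have := expf_neq0 (n i) z0.
  move: (z ^+ n i) => t t0; by field; rewrite t0 zpk Ez.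
- apply: derivableM; first exact: derivable_horner_num.
  apply: derivableV; last exact: derivable_horner_num.
  by rewrite hornerM hornerXn mulf_neq0 // expf_neq0.
Unshelve. all: by end_near.
Qed.

Lemma mulmx_cV_inj (C : comNzRingType) (m n : nat) (A B : 'M[C]_(m, n)) :
  (forall v : 'cV_n, A *m v = B *m v) -> A = B.
Proof.
move=> AB; apply/matrixP => i j; have := AB (delta_mx j 0).
by rewrite -!colE => /matrixP/(_ i 0); rewrite !mxE.
Qed.

(** * The eigenvalue equation and its explicit solution *)

Section Scattering.
Variables (R : realType) (d r q : nat).
Local Notation C := R[i].
Variables (H : 'M[C]_d) (V : 'M[C]_(d, r)).
Hypothesis q_gt0 : (0 < q)%N.
Local Notation a := (sqrtq R q).
Local Notation x := (xparam q).
Local Notation F := (F q H V).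
Local Notation Vs := (adjmx V).

Lemma sqrtq_neq0 : a != 0.
Proof. by rewrite /sqrtq (inj_eq (@complexI R)) sqrtr_eq0 -ltNge ltr0n. Qed.

(* Extending the tail by its value alpha + beta at 0, the second component of
   J f = x f holds if and only if a (alpha + beta) = V^* u; inserting beta into
   the first component produces F. *)
Lemma tail_eigenfunctionP (zeta : C) (alpha beta : 'cV[C]_r) (f : state R d r) :
  zeta != 0 -> has_tail zeta alpha beta f ->
  generalized_eigenfunction q H V (x zeta) f <->
  F zeta *m f.1 = (zeta^-1 - zeta) *: (V *m alpha) /\
  beta = - alpha + a^-1 *: (Vs *m f.1).
Proof.
have a0 := sqrtq_neq0; case: f => u g z0; rewrite /has_tail /= => tail.
pose b0 := - alpha + a^-1 *: (Vs *m u).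
have F1 : (H *m u + V *m (zeta *: alpha + zeta^-1 *: b0) = x zeta *: u) <->
    F zeta *m u = (zeta^-1 - zeta) *: (V *m alpha).
  rewrite /b0 /Defs.F mulmxDl mulmxBl mul_scalar_mx -scalemxAl -mulmxA.
  rewrite mulmxDr -!scalemxAr mulmxDr mulmxN -scalemxAr.
  move: (V *m (_ *m u)) (V *m alpha) (H *m u) => w v h.
  split=> /matrixP E; apply/matrixP => i j; move: (E i j); rewrite !mxE;
    by move=> /eqP; rewrite -subr_eq0 => /eqP e; apply/eqP;
      rewrite -subr_eq0 -e; apply/eqP; ring.
have F2 : (a *: g 1%N + Vs *m u = x zeta *: g 0%N) <-> beta = b0.
  rewrite !tail /b0 /xparam expr1; move: (Vs *m u) => w.
  split=> [/matrixP E|->].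
    apply/matrixP => i j; move: (E i j); rewrite !mxE => e.
    apply: (mulfI a0).
    (* The free recurrence continued to the boundary, a (alpha + beta) = x g(1) - a g(2), solved for
       a beta. *)
    have -> : a * beta i j = a * (zeta + zeta^-1) *
      (zeta * alpha i j + zeta^-1 * beta i j) - a * (zeta ^+ 2 * alpha i j +
       zeta ^- 2 * beta i j) - a * alpha i j by field; rewrite z0.
    by rewrite -e; field; rewrite a0 z0.
  by apply/matrixP => i j; rewrite !mxE; field; rewrite a0 z0.
split.
  rewrite /generalized_eigenfunction /J /= => -[E1 E2].
  have B : beta = b0 by apply/F2; have := congr1 (@^~ 0%N) E2.
  by split=> //; apply/F1; rewrite -E1 -B tail expr1.
move=> [E1 B]; rewrite /generalized_eigenfunction /J /=; congr pair.
  by rewrite tail expr1 B; apply/F1.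
apply/funext => -[|m]; first exact/F2.
(* Interior rows: x zeta^n = a (zeta^(n-1) + zeta^(n+1)), and likewise for zeta^-1. Generalizing
   [zeta ^+ m] leaves [field] with fixed exponents only. *)
rewrite !tail /xparam !exprS; have := expf_neq0 m z0; move: (zeta ^+ m) => t t0.
by apply/matrixP => i j; rewrite !mxE; field; rewrite z0 t0.
Qed.

Definition amplitude (zeta : C) : 'M[C]_(d, r) :=
  (zeta^-1 - zeta) *: (invmx (F zeta) *m V).

Definition scatmx (zeta : C) : 'M[C]_r :=
  - 1%:M + ((zeta^-1 - zeta) / a) *: (Vs *m invmx (F zeta) *m V).

(** Invertibility of F(zeta) solves the first equation for u; substituting u into the second turns
    beta into S(zeta) alpha. *)
Lemma eigenfunction_regularP (zeta : C) (alpha beta : 'cV[C]_r) (f : state R d r) :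
  regular_point q H V zeta -> has_tail zeta alpha beta f ->
  generalized_eigenfunction q H V (x zeta) f <->
  f.1 = amplitude zeta *m alpha /\ beta = scatmx zeta *m alpha.
Proof.
move=> [z0 uF _ _] tail; rewrite tail_eigenfunctionP //.
have E : F zeta *m f.1 = (zeta^-1 - zeta) *: (V *m alpha) <->
    f.1 = amplitude zeta *m alpha.
  rewrite /amplitude -scalemxAl; split=> [e|->].
    by rewrite -[LHS](mulKmx uF) e -scalemxAr mulmxA.
  by rewrite -scalemxAr !mulmxA mulmxV // mul1mx.
have E' : - alpha + a^-1 *: (Vs *m (amplitude zeta *m alpha)) =
    scatmx zeta *m alpha.
  rewrite /scatmx /amplitude mulmxDl mulNmx mul1mx -!scalemxAl -!scalemxAr.
  by rewrite scalerA !mulmxA mulrC.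
rewrite E; split=> -[-> ->]; by rewrite ?E'.
Qed.

(** A matrix is determined by its action on all alpha, so the family is pinned down at regular
    points and meromorphy can be checked on explicit formulas. *)
Lemma scattering_familyP (Psi : C -> mx_state R d r) (S : C -> 'M[C]_r) :
  scattering_family q H V Psi S <->
  forall zeta, regular_point q H V zeta ->
    [/\ (Psi zeta).1 = amplitude zeta, S zeta = scatmx zeta &
      forall n, (Psi zeta).2 n =
        zeta ^+ n.+1 *: 1%:M + zeta ^- n.+1 *: scatmx zeta].
Proof.
split=> [sPsi zeta reg|sPsi zeta reg alpha].
- have eig alpha := (eigenfunction_regularP reg (sPsi zeta reg alpha).2).1
    (sPsi zeta reg alpha).1.
  have SE : S zeta = scatmx zeta by apply: mulmx_cV_inj => v; case: (eig v).
  split=> // [|n]; apply: mulmx_cV_inj => v; first by case: (eig v).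
  rewrite [LHS](sPsi zeta reg v).2 SE.
  by rewrite [RHS]mulmxDl -!(scalemxAl _ _ v) mul1mx.
- have [P1 SE P2] := sPsi zeta reg.
  have tail : has_tail zeta alpha (S zeta *m alpha)
      (mx_state_apply (Psi zeta) alpha).
    by move=> n /=; rewrite P2 SE [LHS]mulmxDl -!(scalemxAl _ _ alpha) mul1mx.
  by split=> //; apply/(eigenfunction_regularP reg tail); rewrite SE -P1.
Qed.

(** * Polynomial matrices and Cramer's rule *)

Definition pencil : 'M[{poly C}]_d :=
  'X *: map_mx polyC H - (a *: ('X^2 + 1))%:M +
  map_mx polyC (a^-1 *: (V *m Vs)).

(* At w = 0 this is the invertible matrix - a, whereas [pencil] at zeta = 0 is
   - a + a^-1 V V^*, possibly singular: hence det F is seen to be not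
   identically zero by looking at zeta = w^-1 near infinity. *)
Definition rpencil : 'M[{poly C}]_d :=
  'X *: map_mx polyC H - (a *: ('X^2 + 1))%:M +
  'X^2 *: map_mx polyC (a^-1 *: (V *m Vs)).

Lemma pencilE (z : C) : z != 0 -> map_mx (horner_eval z) pencil = z *: F z.
Proof.
move=> z0; rewrite /pencil /Defs.F /xparam; move: (V *m Vs) => W.
apply/matrixP => i j; rewrite !mxE /horner_eval !hornerE /=.
by case: eqP => _; rewrite ?mulr1n ?mulr0n ?hornerE /=; field;
  rewrite z0 sqrtq_neq0.
Qed.

Lemma rpencilE (w : C) : w != 0 -> map_mx (horner_eval w) rpencil = w *: F w^-1.
Proof.
move=> w0; rewrite /rpencil /Defs.F /xparam; move: (V *m Vs) => W.
apply/matrixP => i j; rewrite !mxE /horner_eval !hornerE /=.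
by case: eqP => _; rewrite ?mulr1n ?mulr0n ?hornerE /=; field;
  rewrite w0 sqrtq_neq0.
Qed.

Lemma det_rpencil_neq0 : \det rpencil != 0.
Proof.
have E : map_mx (horner_eval 0) rpencil = (- a)%:M.
  apply/matrixP => i j; rewrite !mxE /horner_eval !hornerE /=.
  by case: eqP => _; rewrite ?mulr1n ?mulr0n ?hornerE /=; ring.
have : \det (map_mx (horner_eval 0) rpencil) != 0.
  by rewrite E det_scalar expf_neq0 // oppr_eq0 sqrtq_neq0.
by rewrite det_map_mx; apply: contraNneq => ->; rewrite rmorph0.
Qed.

Lemma det_pencil_horner (z : C) :
  z != 0 -> (\det pencil).[z] = z ^+ d * \det (F z).
Proof. by move=> z0; rewrite -detZ -pencilE // det_map_mx. Qed.

(** If det [pencil] were zero, det F would vanish at every nonzero point, and so would det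
    [rpencil]. *)
Lemma det_pencil_neq0 : \det pencil != 0.
Proof.
(* The factor ['X] forces the chosen nonroot w to be nonzero, so that F can be evaluated at w^-1. *)
have : \det rpencil * 'X != 0 by rewrite mulf_neq0 ?det_rpencil_neq0 ?polyX_eq0.
move=> /closed_nonrootP[w]; rewrite rootE hornerM hornerX mulf_eq0 negb_or.
move=> /andP[rw w0]; apply: contraNneq rw => D0.
have := det_pencil_horner (invr_neq0 w0).
rewrite D0 horner0 => /esym/eqP.
rewrite mulf_eq0 expf_eq0 invr_eq0 (negbTE w0) andbF /= => /eqP F0.
rewrite -[(\det _).[w]]/(horner_eval w (\det rpencil)) -det_map_mx.
by rewrite rpencilE // detZ F0 mulr0.
Qed.

(** Cramer's rule applied to z F(z); the prefactor z passes from its inverse to that of F(z). *)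
Lemma invmx_F (z : C) : z != 0 -> (\det pencil).[z] != 0 ->
  invmx (F z) = (z / (\det pencil).[z]) *: map_mx (horner_eval z) (\adj pencil).
Proof.
move=> z0 Dz; have uF : F z \in unitmx.
  by rewrite unitmxE unitfE; apply: contraNneq Dz => D0;
    rewrite det_pencil_horner // D0 mulr0.
apply: (can_inj (mulKmx uF)); rewrite mulmxV // -scalemxAr.
rewrite map_mx_adj; have := mul_mx_adj (map_mx (horner_eval z) pencil).
rewrite det_map_mx {1}pencilE // -scalemxAl.
move=> /(congr1 ( *:%R (\det pencil).[z]^-1)).
rewrite scalerA mulrC => ->.
by rewrite scale_scalar_mx /horner_eval mulVf.
Qed.

(** * Numerators over a common denominator *)

(* The factor 'X * ('X^2 - 1) makes every nonroot a regular point. *)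
Definition scattering_denom : {poly C} := ('X * ('X^2 - 1)) * \det pencil.

Lemma scattering_denom_neq0 : scattering_denom != 0.
Proof.
rewrite !mulf_neq0 ?det_pencil_neq0 ?polyX_eq0 //.
by rewrite -size_poly_eq0 size_XnsubC.
Qed.

Lemma scattering_denom_regular (z : C) :
  scattering_denom.[z] != 0 -> regular_point q H V z.
Proof.
rewrite !hornerE /= !mulf_eq0 !negb_or => /andP[/andP[z0 z1] Dz]; split=> //.
- by rewrite unitmxE unitfE; apply: contraNneq Dz => D0;
    rewrite det_pencil_horner // D0 mulr0.
- by apply: contraNneq z1 => ->; rewrite expr1n subrr.
- by apply: contraNneq z1 => ->; rewrite sqrrN expr1n subrr.
Qed.

(** Cramer's rule gives (z^-1 - z) F(z)^-1 the prefactor 1 - z^2; passing to [scattering_denom]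
    multiplies it by z (z^2 - 1), hence the sign and the square. *)
Definition amplitude_num : 'M[{poly C}]_(d, r) :=
  (- ('X * ('X^2 - 1) ^+ 2)) *: (\adj pencil *m map_mx polyC V).

Definition scatmx_num : 'M[{poly C}]_r :=
  - scattering_denom%:M + map_mx polyC (a^-1 *: Vs) *m amplitude_num.

Let map_horner_polyC (m n : nat) (A : 'M[C]_(m, n)) (z : C) :
  map_mx (horner_eval z) (map_mx polyC A) = A.
Proof. by apply/matrixP => i j; rewrite !mxE /horner_eval hornerC. Qed.

Lemma amplitude_rational (z : C) : scattering_denom.[z] != 0 ->
  amplitude z = scattering_denom.[z]^-1 *: map_mx (horner_eval z) amplitude_num.
Proof.
rewrite /scattering_denom => Mz; have [z0 uF _ _] := scattering_denom_regular Mz.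
move: Mz; rewrite hornerM mulf_eq0 negb_or => /andP[Xz Dz].
rewrite /amplitude invmx_F // /amplitude_num map_mxZ map_mxM map_horner_polyC.
rewrite -scalemxAl !scalerA; congr (_ *: _).
move: Xz Dz; move: (\det pencil).[z] => D.
rewrite !hornerE /= mulf_eq0 negb_or => /andP[_ z1] D0.
by rewrite /horner_eval !hornerE /=; field; rewrite z0 D0 z1.
Qed.

Lemma scatmx_rational (z : C) : scattering_denom.[z] != 0 ->
  scatmx z = scattering_denom.[z]^-1 *: map_mx (horner_eval z) scatmx_num.
Proof.
move=> Mz; have -> : scatmx z = - 1%:M + a^-1 *: Vs *m amplitude z.
  by rewrite /amplitude -scalemxAl -!scalemxAr scalerA mulmxA mulrC.
rewrite amplitude_rational // /scatmx_num map_mxD map_mxN map_mxM.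
rewrite map_horner_polyC map_scalar_mx /= scalerDr scalemxAr; congr (_ + _).
by rewrite scalerN scale_scalar_mx /horner_eval mulVf.
Qed.

(** The tail z^(n+1) + z^-(n+1) S is put over z^(n+1) times [scattering_denom]. The exponents
    [mx_state_pole] are unbounded in n, but their power of z vanishes only at the excluded point
    0. *)
Definition mx_state_num (i : ('I_d * 'I_r) + nat * ('I_r * 'I_r)) : {poly C} :=
  match i with
  | inl ij => amplitude_num ij.1 ij.2
  | inr (n, ij) => 'X^(2 * n.+1) * scattering_denom * (ij.1 == ij.2)%:R
                   + scatmx_num ij.1 ij.2
  end.

Definition mx_state_pole (i : ('I_d * 'I_r) + nat * ('I_r * 'I_r)) : nat :=
  match i with inl _ => 0 | inr (n, _) => n.+1 end.

Lemma scattering_family_meromorphic (Psi : C -> mx_state R d r)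
    (S : C -> 'M[C]_r) :
  scattering_family q H V Psi S ->
  meromorphic_on [set z : C | z != 0] (fun zeta => mx_state_coords (Psi zeta)) /\
  meromorphic_on [set z : C | z != 0] (fun zeta => mx_coords (S zeta)).
Proof.
move=> /scattering_familyP sPsi; split.
- apply: (@rational_meromorphic _ _ _ scattering_denom mx_state_num mx_state_pole).
    exact: scattering_denom_neq0.
  move=> z Mz i; have reg := scattering_denom_regular Mz.
  have [P1 _ P2] := sPsi z reg; have [z0 _ _ _] := reg.
  case: i => [[i j]|[n [i j]]] /=; rewrite /mx_coords /=.
    by rewrite P1 amplitude_rational // !mxE /horner_eval expr0 mul1r mulrC.
  rewrite P2 scatmx_rational //; move: scattering_denom scatmx_num Mz => M K Mz.
  rewrite !mxE hornerD !hornerM hornerXn mulnC exprM.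
  rewrite -(rmorph_nat (@polyC C)) hornerC /horner_eval.
  have := expf_neq0 n.+1 z0; move: (z ^+ n.+1) => t t0.
  by field; rewrite Mz t0.
- apply: (@rational_meromorphic _ _ _ scattering_denom
    (fun ij => scatmx_num ij.1 ij.2) (fun=> 0%N)).
    exact: scattering_denom_neq0.
  move=> z Mz [i j]; have [_ SE _] := sPsi z (scattering_denom_regular Mz).
  by rewrite /mx_coords SE scatmx_rational // !mxE /horner_eval expr0 mul1r mulrC.
Qed.

End Scattering.

Theorem theorem2p5 (R : realType) (q d r : nat) (hq : is_prime_power q)
    (hd : (0 < d)%N) (hr : (0 < r)%N)
    (H : 'M[R[i]]_d) (hH : H = adjmx H) (V : 'M[R[i]]_(d, r)) :
  [/\ forall (zeta : R[i]), regular_point q H V zeta ->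
        forall alpha : 'cV[R[i]]_r,
        exists! f : state R d r,
          generalized_eigenfunction q H V (xparam q zeta) f /\
          exists beta : 'cV[R[i]]_r, has_tail zeta alpha beta f,
      exists (Psi : R[i] -> mx_state R d r) (S : R[i] -> 'M[R[i]]_r),
        scattering_family q H V Psi S
    & forall (Psi : R[i] -> mx_state R d r) (S : R[i] -> 'M[R[i]]_r),
        scattering_family q H V Psi S ->
        [/\ forall (zeta : R[i]), regular_point q H V zeta ->
              forall alpha : 'cV[R[i]]_r,
              (mx_state_apply (Psi zeta) alpha).1 =
                (zeta^-1 - zeta) *: (invmx (F q H V zeta) *m V *m alpha),
            forall (zeta : R[i]), regular_point q H V zeta ->
              S zeta = - 1%:M + ((zeta^-1 - zeta) / sqrtq R q) *:
                         (adjmx V *m invmx (F q H V zeta) *m V),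
            meromorphic_on [set z : R[i] | z != 0]
              (fun zeta => mx_state_coords (Psi zeta))
          & meromorphic_on [set z : R[i] | z != 0]
              (fun zeta => mx_coords (S zeta))]].
Proof.
have q0 : (0 < q)%N by case: hq => p [k [pp _ ->]]; rewrite expn_gt0 prime_gt0.
split.
- move=> zeta reg alpha.
  pose S := scatmx q H V zeta.
  pose f : state R d r := (amplitude q H V zeta *m alpha,
    fun n => zeta ^+ n.+1 *: alpha + zeta ^- n.+1 *: (S *m alpha)).
  have tail : has_tail zeta alpha (S *m alpha) f by [].
  exists f; split.
    by split; [apply/(eigenfunction_regularP q0 reg tail)|exists (S *m alpha)].
  move=> [u g] [eig [beta tail']].
  (* Both u and beta are forced, and beta fixes the whole sequence through the tail. *)
  have [/= uE bE] := (eigenfunction_regularP q0 reg tail').1 eig.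
  rewrite /f -uE; congr pair; apply/funext => n.
  by have /= -> := tail' n; rewrite bE.
(* At nonregular points the formulas take default values of [invmx] and of the inverse, which
   [scattering_family] leaves free. *)
- exists (fun zeta => (amplitude q H V zeta,
    fun n => zeta ^+ n.+1 *: 1%:M + zeta ^- n.+1 *: scatmx q H V zeta)).
  by exists (scatmx q H V); apply/scattering_familyP.
- move=> Psi S sPsi; have [mPsi mS] := scattering_family_meromorphic q0 sPsi.
  have PsiE := (scattering_familyP H V q0 Psi S).1 sPsi.
  split=> // zeta reg; last by have [] := PsiE zeta reg.
  by move=> alpha /=; have [-> _ _] := PsiE zeta reg; rewrite -scalemxAl.
Qed.
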